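(* As $k\to\infty$, we have $\mathfrak{D}(k)\le k/3+o(k)$. Here, for $k\in\mathbb{N}$, $\mathfrak{D}(k)$ denotes the largest integer $D$ such that $\mathbb{P}\left(\mathscr{C}(G_{1/2})\ge D\right)\ge 1/2$ for all finite graphs $G$ with minimum degree $\delta(G)\ge k$, where $\mathscr{C}$ denotes the colouring number.
   Context: Graphs are simple and undirected. For a graph $G$ and $p\in(0,1)$, $G_p$ denotes the random subgraph of $G$ on the same vertex set obtained by including each edge of $G$ independently with probability $p$. The colouring number $\mathscr{C}(G)$ of a graph $G$ is the minimum integer $c$ such that every (non-empty) subgraph of $G$ has a vertex of degree less than $c$ in that subgraph; equivalently, the least $c$ for which there is an ordering of the vertices of $G$ in which each vertex has fewer than $c$ neighbours preceding it. *)

(* Defs.v *)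
From HB Require Import structures.
From mathcomp Require Import all_boot all_order all_algebra.
From mathcomp Require Import boolp reals.
Set Implicit Arguments.
Unset Strict Implicit.
Unset Printing Implicit Defensive.
Import Order.TTheory GRing.Theory Num.Theory.
Local Open Scope ring_scope.

(* A graph on the vertex set [T : finType] is given by its edge set
   [E : {set {set T}}], whose elements are unordered pairs of distinct
   vertices. *)

Section Graphs.
Variable T : finType.
Implicit Types (E F : {set {set T}}) (W : {set T}).

Definition simple_graph E : bool := [forall e in E, #|e| == 2%N].

Definition degree E (v : T) : nat := #|[set e in E | v \in e]|.

(* Subgraphs need be neither induced nor spanning: [W] is the vertex set and
   [F] the edge set of the subgraph. *)
Definition subgraph E W F : bool :=
  (F \subset E) && [forall e in F, e \subset W].

Definition low_degree_in_subgraphs E (c : nat) : bool :=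
  [forall W, forall F, (W != set0) && subgraph E W F ==>
    [exists v in W, (degree F v < c)%N]].

Lemma low_degree_in_subgraphs_card E : low_degree_in_subgraphs E #|E|.+1.
Proof.
apply/forallP => W; apply/forallP => F; apply/implyP.
case/andP => /set0Pn[v vW] /andP[sFE _]; apply/existsP; exists v.
rewrite vW ltnS (leq_trans _ (subset_leq_card sFE)) //.
by apply/subset_leq_card/subsetP => e; rewrite inE => /andP[].
Qed.

Lemma ex_low_degree_in_subgraphs E : exists c, low_degree_in_subgraphs E c.
Proof. by exists #|E|.+1; exact: low_degree_in_subgraphs_card. Qed.

Definition colouring_number E : nat := ex_minn (ex_low_degree_in_subgraphs E).

Lemma colouring_number_le E : (colouring_number E <= #|E|.+1)%N.
Proof.
rewrite /colouring_number; case: ex_minnP => m _; apply.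
exact: low_degree_in_subgraphs_card.
Qed.

(* [prob_subgraph p E A] is P(E_p \in A): the random subgraph E_p has vertex
   set [T], and its edge set is F with probability
   p^|F| * (1 - p)^(|E| - |F|) for each subset F of E. *)
Definition prob_subgraph (R : realType) (p : R) E (A : pred {set {set T}}) : R :=
  \sum_(F in powerset E | A F) p ^+ #|F| * (1 - p) ^+ (#|E| - #|F|).

End Graphs.

(* The null graph, whose minimum degree is not defined, is excluded. *)
Definition colouring_bound (R : realType) (k D : nat) : Prop :=
  forall (T : finType) (E : {set {set T}}),
    (0 < #|T|)%N -> simple_graph E -> (forall v, (k <= degree E v)%N) ->
    2^-1 <= prob_subgraph (2^-1 : R) E
              (fun F => (D <= colouring_number F)%N).

Lemma colouring_bound0 (R : realType) (k : nat) : colouring_bound R k 0.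
Proof.
move=> T E _ _ _; rewrite /prob_subgraph.
rewrite (eq_bigl (fun F => F \in powerset E)); last by move=> F; rewrite andbT.
rewrite (eq_bigr (fun=> 2^-1 ^+ #|E|)); last first.
  move=> F; rewrite powersetE => /subset_leq_card leFE.
  have -> : 1 - 2^-1 = 2^-1 :> R by rewrite {1}[1](splitr 1) mul1r addrK.
  by rewrite -exprD subnKC.
rewrite sumr_const card_powerset -[X in _ <= X]mulr_natl natrX.
rewrite -exprMn divff ?pnatr_eq0 //.
by rewrite expr1n invf_le1 ?ler1n.
Qed.

Lemma colouring_bound_le (R : realType) (k D : nat) :
  `[< colouring_bound R k D >] -> (D <= 'C(k.+1, 2).+1)%N.
Proof.
move=> /asboolP; pose E := [set e : {set 'I_k.+1} | #|e| == 2%N].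
have <- : #|E| = 'C(k.+1, 2) by rewrite card_draws card_ord.
move=> /(_ _ E); rewrite card_ord => /(_ isT) H.
have {}H : 2^-1 <= prob_subgraph (2^-1 : R) E
    (fun F => (D <= colouring_number F)%N).
  apply: H.
    by apply/forallP => e; apply/implyP; rewrite inE.
  move=> v.
  have inj : {in [set~ v] &, injective (fun w => [set v; w])}.
    move=> w w'; rewrite !inE => wv w'v eq_vw.
    have := set22 v w; rewrite eq_vw !inE (negbTE wv) /=.
    by move/eqP.
  have card_im : #|[set [set v; w] | w in [set~ v]]| = k.
    by rewrite (card_in_imset inj) cardsC1 card_ord.
  rewrite -[X in (X <= _)%N]card_im.
  apply/subset_leq_card/subsetP => e /imsetP[w]; rewrite !inE => wv ->.
  by rewrite cards2 (eq_sym v) wv set21.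
rewrite leqNgt; apply/negP => ltD; move: H.
rewrite /prob_subgraph big_pred0 ?invr_le0 ?lern0 // => F.
apply/negP => /andP[]; rewrite powersetE => /subset_leq_card leFE leD.
have := leq_trans leD (colouring_number_le F).
by rewrite leqNgt (leq_ltn_trans _ ltD).
Qed.

Lemma ex_colouring_bound (R : realType) (k : nat) :
  exists D, `[< colouring_bound R k D >].
Proof. by exists 0%N; apply/asboolP; exact: colouring_bound0. Qed.

(* [colouring_bound_le] only witnesses that a maximum exists; its bound does
   not affect the value of [frakD]. *)
Definition frakD (R : realType) (k : nat) : nat :=
  ex_maxn (ex_colouring_bound R k) (@colouring_bound_le R k).

(* Main.v *)
Require Import Defs.
From HB Require Import structures.
From mathcomp Require Import all_boot all_order all_algebra.
From mathcomp Require Import all_classical all_reals all_analysis.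
From mathcomp Require Import fintype finset.
From mathcomp Require Import zify ring lra.
Import Order.TTheory GRing.Theory Num.Theory.
Import numFieldNormedType.Exports.
Set Implicit Arguments.
Unset Strict Implicit.
Unset Printing Implicit Defensive.
Local Open Scope ring_scope.

(** It is enough to find, for every eps > 0 and every large k, one graph of
minimum degree at least k whose random subgraph F has colouring number at most
k/3 + eps k with probability more than 1/2.

The graph. Take a cubic graph H of large girth, replace each vertex x by a
blob of m vertices, m being about k/3, and join adjacent blobs completely.  All
degrees are 3m >= k.  In F a vertex typically has m/2 neighbours in each of
the three adjacent blobs.

Peeling. A subgraph of F in which all degrees exceed m + 2t cannot meet a blob
once it is known to miss two adjacent blobs, since at most m neighbours
remain; and it cannot meet a typical blob once it is known to miss one adjacent
blob, since only about m/2 + m/2 neighbours remain.  Here t is a small multiple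
of m that absorbs the fluctuations.  So along H the absence of edges spreads
from a single empty bundle (two adjacent blobs without any edge of F between
them) through all typical blobs; atypical ones only delay it.  The predicate
[cleared d c x] records that this process, run inside the ball of radius d
around the blob x and only on the side of x away from its neighbour of colour
c, empties the bundle between x and that neighbour.  If every bundle is cleared,
then the colouring number is at most m + 2t + 1 ([colouring_number_cleared]).

Probability. As the balls of H are trees, the events for the two branches
below x are independent ([region_disjoint], [Pr_indep]).  Let p(d) bound the
probability that a bundle is not cleared at depth d, and q the probability
that a blob is atypical towards a given neighbour.
- At depth 0 a bundle is empty with probability 2^-(m^2): tiny, but positive.
  Either of two branches suffices at a typical blob, so that the probability of
  success grows by a factor 5/4 at each level until it reaches 1/2
  ([cleared_growth]).
- Afterwards failure needs two failed branches, or a failed branch together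
  with an atypical blob, which gives p(d+2) <= r (r + 6 q) when
  p(d), p(d+1) <= r ([cleared_decay]).  Since q is as small as desired for
  large m (by the Chernoff bound [chernoff_rate]), p(d) decays at any prescribed
  exponential rate.

The union bound. A cubic graph with balls of radius d that are trees has at
least 2^d vertices, and the union bound is over all of them.  The graph H used
here has 16^(2d) vertices ([card_useries]), which is exponential in d, and the
rate of decay of p beats it ([frakD_le]).  It is a Cayley-type graph: its
vertices are the series 1 + X_1 T + ... + X_n T^n of 2 x 2 matrices over the
field with two elements, truncated at degree n, and the neighbour of colour c
of a series is its product with 1 + N_c T, where N_0, N_1, N_2 are the three
nonzero nilpotent matrices.  A product of l such factors without immediate
repetition has degree exactly l, hence fixes no series when 0 < l <= n
([series_nb_acyclic]). *)

(** * Walks in an edge-coloured cubic graph *)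

Definition reduced (w : seq 'I_3) : bool := sorted (fun a b => a != b) w.

Definition walk (V : Type) (nb : 'I_3 -> V -> V) (w : seq 'I_3) (x : V) : V :=
  foldl (fun y c => nb c y) x w.

(** The edges are coloured by 'I_3 and [nb c x] is the neighbour of x of colour c.
A walk is non-backtracking when its word of colours is reduced, so that this says
that the girth exceeds n. *)
Definition acyclic_up_to (V : eqType) (nb : 'I_3 -> V -> V) (n : nat) : Prop :=
  forall w x, w != [::] -> reduced w -> (size w <= n)%N -> walk nb w x != x.

Lemma reduced_rconsW w a : reduced (rcons w a) -> reduced w.
Proof. by case: w => [|c w] //=; rewrite /reduced /= rcons_path => /andP[]. Qed.

Lemma reduced_rev w : reduced (rev w) = reduced w.
Proof.
rewrite /reduced rev_sorted; apply: eq_sorted => a b.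
by rewrite eq_sym.
Qed.

Section WalkUniqueness.
Variables (V : eqType) (nb : 'I_3 -> V -> V) (n : nat).
Hypothesis nbK : forall c, involutive (nb c).
Hypothesis nb_free : acyclic_up_to nb n.

Lemma walk_cat w1 w2 x : walk nb (w1 ++ w2) x = walk nb w2 (walk nb w1 x).
Proof. by rewrite /walk foldl_cat. Qed.

Lemma walk_rcons w c x : walk nb (rcons w c) x = nb c (walk nb w x).
Proof. by rewrite -cats1 walk_cat. Qed.

Lemma walk_revK w x : walk nb (rev w) (walk nb w x) = x.
Proof.
elim/last_ind: w x => [|w c IH] x //=.
by rewrite rev_rcons walk_rcons /= nbK IH.
Qed.

Lemma reduced_cat_rev w a w' a' : a != a' ->
  reduced (rcons w a) -> reduced (rcons w' a') ->
  reduced (rcons w a ++ rev (rcons w' a')).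
Proof.
rewrite -(reduced_rev (rcons w' a')) rev_rcons /reduced /= => aa'.
by case: w => [|e w] /=; [rewrite aa'|rewrite cat_path last_rcons /= aa' => ->].
Qed.

(** Two distinct walks with the same endpoints would close up, after their common
final letters are stripped, into a non-backtracking cycle. *)
Lemma walk_unique w1 w2 x : reduced w1 -> reduced w2 ->
  (size w1 + size w2 <= n)%N -> walk nb w1 x = walk nb w2 x -> w1 = w2.
Proof.
have closed w : reduced w -> (size w <= n)%N -> walk nb w x = x -> w = [::].
  move=> rw sw /eqP E; apply/eqP; apply: contraLR E => w0.
  exact: nb_free.
elim/last_ind: w1 w2 => [|w1 a IH] w2.
  by move=> _ r2 s2 /esym/closed->.
case/lastP: w2 => [|w2 b] r1 r2 s12 E.
  by apply: closed => //; rewrite addn0 in s12.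
have [ab|ab] := eqVneq a b.
  rewrite -ab in r2 s12 E *; congr rcons.
  apply: IH; first exact: reduced_rconsW r1.
  - exact: reduced_rconsW r2.
  - by move: s12; rewrite !size_rcons; lia.
  by apply: (inv_inj (nbK a)); rewrite -!walk_rcons.
have := closed _ (reduced_cat_rev ab r1 r2).
rewrite size_cat size_rev walk_cat E walk_revK => /(_ s12 erefl).
by case: (w1).
Qed.

End WalkUniqueness.

(** * Cubic graphs of large girth *)

(** The three nonzero vectors of the plane over the field with two elements. *)
Definition vec (c : 'I_3) : 'cV['F_2]_2 :=
  \col_i ((nat_of_ord c == 2%N) || (nat_of_ord i == nat_of_ord c))%:R.

(** The linear form whose kernel is spanned by [vec c]. *)
Definition covec (c : 'I_3) : 'rV['F_2]_2 :=
  \row_i ((nat_of_ord c == 2%N) || (nat_of_ord i != nat_of_ord c))%:R.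

Lemma covecM c d : covec c *m vec d = (c != d)%:R%:M.
Proof.
apply/matrixP => i j; rewrite !mxE !big_ord_recl big_ord0 !mxE !ord1 /= mulr1n.
by case: c d => [[|[|[|]]] ?] // [[|[|[|]]] ?] //; apply/eqP.
Qed.

Definition nilp c : 'M['F_2]_2 := vec c *m covec c.

Lemma nilp_sq c : nilp c * nilp c = 0.
Proof.
rewrite /nilp -mulmxE mulmxA -(mulmxA (vec c)) covecM eqxx.
by rewrite mul_mx_scalar scale0r mul0mx.
Qed.

Lemma vec_covec_neq0 c d : vec c *m covec d != 0.
Proof.
apply/eqP => /matrixP H.
pose i (c : 'I_3) : 'I_2 := inord (c == 1%N :> nat).
pose j (c : 'I_3) : 'I_2 := inord (c == 0%N :> nat).
have := H (i c) (j d); rewrite !mxE big_ord_recl big_ord0 addr0 !mxE !inordK;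
  last by case: eqP.
  by case: c d {H} => [[|[|[|]]] ?] // [[|[|[|]]] ?] //= /eqP.
by case: eqP.
Qed.

(** The inner factors [covec c *m vec d] are all 1, because consecutive letters
differ: the product telescopes and is never zero. *)
Lemma prod_nilp c w : reduced (c :: w) ->
  \prod_(a <- c :: w) nilp a = vec c *m covec (last c w).
Proof.
elim: w c => [|d w IH] c; first by rewrite big_seq1.
rewrite /reduced /= => /andP[cd rw]; rewrite big_cons IH // /nilp -mulmxE.
by rewrite mulmxA -(mulmxA (vec c)) covecM cd mul_mx_scalar scale1r.
Qed.

Definition wordpoly (w : seq 'I_3) : {poly 'M['F_2]_2} :=
  \prod_(c <- w) (1 + (nilp c)%:P * 'X).

(** The top coefficient of the product of the factors is the product of their top
coefficients, which [prod_nilp] computes. *)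
Lemma wordpoly_top w : (size (wordpoly w) <= (size w).+1)%N /\
  (wordpoly w)`_(size w) = \prod_(a <- w) nilp a.
Proof.
rewrite /wordpoly; elim/last_ind: w => [|w c [IH1 IH2]].
  by rewrite !big_nil size_poly1 coef1.
rewrite -cats1 !big_cat /= !big_seq1 size_cat /= addn1 mulrDr mulr1 mulrA.
split.
  apply: (leq_trans (size_polyD _ _)); rewrite geq_max (leq_trans IH1) //=.
  apply: (leq_trans (size_polyMleq _ _)); rewrite size_polyX addn2 /= ltnS.
  apply: leq_trans IH1; apply: (leq_trans (size_polyMleq _ _)).
  rewrite -subn1 leq_subLR addnC leq_add2r; exact: size_polyC_leq1.
by rewrite coefD coefMX /= coefMC IH2 nth_default ?add0r.
Qed.

Section SeriesGraph.
Variable n : nat.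

(** The series 1 + X_1 T + ... + X_n T^n modulo T^(n+1), given by X_1, ..., X_n;
the constant term 1 is left implicit.  Having an invertible constant term is what
makes every such series cancellable. *)
Definition useries : finType := {ffun 'I_n -> 'M['F_2]_2}.

Definition ucoef (x : useries) (j : nat) : 'M['F_2]_2 :=
  if j is j'.+1 then (if insub j' is Some i then x i else 0) else 1.

Definition series_nb (c : 'I_3) (x : useries) : useries :=
  [ffun i : 'I_n => ucoef x i.+1 + ucoef x i * nilp c].

Lemma ucoefE x (i : 'I_n) : ucoef x i.+1 = x i.
Proof. by rewrite /= valK. Qed.

Lemma ucoef_series_nb c x j : (j < n)%N ->
  ucoef (series_nb c x) j.+1 = ucoef x j.+1 + ucoef x j * nilp c.
Proof. by move=> jn; rewrite -[j]/(val (Ordinal jn)) ucoefE ffunE. Qed.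

(** In characteristic two, the square of 1 + N T is 1 when N squares to 0. *)
Lemma series_nbK c : involutive (series_nb c).
Proof.
move=> x; apply/ffunP => i; rewrite ffunE ucoef_series_nb // ucoefE.
have -> : ucoef (series_nb c x) i * nilp c = ucoef x i * nilp c.
  case: i => [[|j] ji] //=; rewrite -!/(ucoef _ _.+1) ucoef_series_nb 1?ltnW //.
  by rewrite mulrDl -mulrA nilp_sq mulr0 addr0.
rewrite -addrA -mulr2n -scaler_nat (_ : 2%:R = 0 :> 'F_2) ?scale0r ?addr0 //.
exact/eqP.
Qed.

Definition series_poly (x : useries) : {poly 'M['F_2]_2} :=
  \poly_(j < n.+1) ucoef x j.

(** Up to degree n, walking along w multiplies a series by [wordpoly w]. *)
Lemma series_poly_walk w x j : (j <= n)%N ->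
  (series_poly (walk series_nb w x))`_j = (series_poly x * wordpoly w)`_j.
Proof.
rewrite /wordpoly; elim/last_ind: w j => [|w c IH] j jn.
  by rewrite big_nil mulr1.
rewrite walk_rcons -cats1 big_cat big_seq1 /= mulrA mulrDr mulr1 mulrA.
rewrite coefD coefMX coefMC -IH // !coef_poly !ltnS jn.
case: j jn => [|j] jn; first by rewrite addr0.
by rewrite ucoef_series_nb // -IH ?coef_poly ?ltnS ltnW // ltnW.
Qed.

(** If x W = x modulo T^(n+1), where W is the polynomial of a word of length
l <= n, then W = 1 up to degree n because x has constant term 1; but its
coefficient of degree l is not zero. *)
Lemma series_nb_acyclic : acyclic_up_to series_nb n.
Proof.
move=> w x w0 rw wn; apply/eqP => E.
pose W := wordpoly w - 1.
have W0 j : (j <= n)%N -> (series_poly x * W)`_j = 0.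
  by move=> jn; rewrite mulrBr mulr1 coefB -series_poly_walk // E subrr.
have {}W0 j : (j <= n)%N -> W`_j = 0.
  elim/ltn_ind: j => j IH jn; have := W0 j jn.
  rewrite coefM big_ord_recl big1 => [|i _]; last first.
    by rewrite IH ?mulr0 //= /bump; have := ltn_ord i; lia.
  by rewrite addr0 subn0 coef_poly /= mul1r.
have := W0 _ wn; rewrite coefB (wordpoly_top w).2 coef1.
case: w w0 rw {E W W0 wn} => // c w _ rw.
rewrite prod_nilp // subr0 => /eqP.
by rewrite (negbTE (vec_covec_neq0 _ _)).
Qed.

Lemma card_useries : #|useries| = (16 ^ n)%N.
Proof. by rewrite card_ffun card_ord card_mx card_Fp. Qed.
End SeriesGraph.

(** * Uniform random subsets of a finite set *)

Section UniformSubset.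
Variables (R : realType) (X : finType) (E : {set X}).
Implicit Types (A B : pred {set X}) (D F G : {set X}).

Definition events A : {set {set X}} := [set F in powerset E | A F].

Definition Pr A : R := #|events A|%:R / 2 ^+ #|E|.

Definition determined_by D A : Prop :=
  forall F G, F :&: D = G :&: D -> A F = A G.

Lemma pow2_gt0 : 0 < 2 ^+ #|E| :> R.
Proof. by rewrite exprn_gt0. Qed.

Lemma PrT : Pr predT = 1.
Proof.
rewrite /Pr /events (_ : [set F in _ | _] = powerset E).
  by rewrite card_powerset natrX divff // gt_eqF // pow2_gt0.
by apply/setP => F; rewrite !inE andbT.
Qed.

Lemma Pr_le A B : (forall F, F \subset E -> A F -> B F) -> Pr A <= Pr B.
Proof.
move=> AB; rewrite ler_pM2r ?invr_gt0 ?pow2_gt0 // ler_nat.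
apply/subset_leq_card/subsetP => F; rewrite !inE.
by case/andP=> FE /(AB _ FE)->; rewrite FE.
Qed.

Lemma eq_Pr A B : A =1 B -> Pr A = Pr B.
Proof. by move=> AB; apply/le_anti/andP; split; apply: Pr_le => F _; rewrite AB. Qed.

Lemma Pr_ge0 A : 0 <= Pr A.
Proof. by rewrite mulr_ge0 // invr_ge0 ltW // pow2_gt0. Qed.

Lemma PrUI A B : Pr (predU A B) + Pr (predI A B) = Pr A + Pr B.
Proof.
rewrite /Pr -!mulrDl -!natrD -(cardsUI (events A)); congr ((_ + _)%:R / _).
  by congr #|pred_of_set _|; apply/setP => F; rewrite !inE; case: (F \subset E).
congr #|pred_of_set _|; apply/setP => F; rewrite !inE; case: (F \subset E) => //=.
Qed.

Lemma PrU_le A B : Pr (predU A B) <= Pr A + Pr B.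
Proof. by rewrite -PrUI lerDl Pr_ge0. Qed.

Lemma Pr0 : Pr pred0 = 0.
Proof.
rewrite /Pr (_ : events _ = set0) ?cards0 ?mul0r //.
by apply/setP => F; rewrite !inE andbF.
Qed.

Lemma PrC A : Pr (predC A) = 1 - Pr A.
Proof.
apply/eqP; rewrite -PrT eq_sym subr_eq addrC -PrUI (@eq_Pr (predU _ _) predT).
  rewrite (@eq_Pr (predI _ _) pred0) => [|F /=]; last by rewrite andbN.
  by rewrite Pr0 addr0.
by move=> F /=; rewrite orbN.
Qed.

Lemma Pr_exists_le (I : finType) (A : I -> pred {set X}) (r : R) :
  (forall i, Pr (A i) <= r) ->
  Pr (fun F => [exists i, A i F]) <= #|I|%:R * r.
Proof.
move=> Ar; rewrite cardE.
suff H (s : seq I) :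
  Pr (fun F => has (A^~ F) s) <= (size s)%:R * r.
  rewrite (@eq_Pr _ (fun F => has (A^~ F) (enum I))) ?H // => F.
  by apply/existsP/hasP => -[i]; exists i; rewrite ?mem_enum.
elim: s => [|i s IH]; first by rewrite mul0r Pr0.
rewrite /= -natr1 mulrDl mul1r addrC.
by apply: le_trans (lerD (Ar i) IH); apply: PrU_le.
Qed.

Lemma determined_byW D1 D2 A : D1 \subset D2 ->
  determined_by D1 A -> determined_by D2 A.
Proof.
by move=> D12 dA F G FG; apply: dA; rewrite -(setIidPr D12) !setIA FG.
Qed.

Lemma determined_byI D A B : determined_by D A -> determined_by D B ->
  determined_by D (predI A B).
Proof. by move=> dA dB F G FG; rewrite /= (dA F G) ?(dB F G). Qed.

Lemma determined_byC D A : determined_by D A -> determined_by D (predC A).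
Proof. by move=> dA F G FG; rewrite /= (dA F G). Qed.

(** Exchange, in a pair of subsets (F, G), the parts outside of D1.  This
involution carries the pairs in which F satisfies both A and B onto the pairs
in which F satisfies A and G satisfies B. *)
Lemma Pr_indep D1 D2 A B : [disjoint D1 & D2] ->
  determined_by D1 A -> determined_by D2 B ->
  Pr (predI A B) = Pr A * Pr B.
Proof.
move=> dD dA dB.
pose mix F G : {set X} := (F :&: D1) :|: (G :\: D1).
have mixA F G : A (mix F G) = A F.
  by apply: dA; apply/setP => e; rewrite !inE; case: (e \in D1);
     rewrite ?andbF ?orbF ?andbT.
have mixB F G : B (mix F G) = B G.
  apply: dB; apply/setP => e; rewrite !inE.
  case: (boolP (e \in D2)); rewrite ?andbF // => e2.
  by rewrite (disjointFl dD e2) /= andbF.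
have mixE F G : F \subset E -> G \subset E -> mix F G \subset E.
  move=> /subsetP FE /subsetP GE; apply/subsetP => e; rewrite !inE.
  by case/orP => /andP[]; [move/FE|move=> _ /GE].
pose f (p : {set X} * {set X}) := (mix p.1 p.2, mix p.2 p.1).
have fK : involutive f.
  by move=> [F G]; congr pair; apply/setP => e; rewrite !inE;
     case: (e \in D1); rewrite ?andbF ?andbT ?orbF.
have card_eq : (#|events (predI A B)| * #|powerset E| = #|events A| * #|events B|)%N.
  rewrite -!cardsX -(card_imset _ (inv_inj fK)); congr #|pred_of_set _|.
  apply/setP => -[F G]; rewrite -{1}[(F, G)]fK mem_imset; last exact: inv_inj.
  rewrite !inE /= mixA mixB.
  apply/idP/idP.
    by case/andP => /andP[FE /andP[-> ->]] GE;
       have := mixE _ _ FE GE; have := mixE _ _ GE FE; have := fK (F, G);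
       rewrite /f /= => -[-> ->] -> ->.
  by case/andP => /andP[FE ->] /andP[GE ->]; rewrite !mixE.
rewrite /Pr mulrACA -natrM -card_eq card_powerset natrM natrX.
have := pow2_gt0 => /gt_eqF/negbT E0; field.
exact: E0.
Qed.

Lemma Pr_avoid D : D \subset E -> Pr (fun F => F :&: D == set0) = 2 ^- #|D|.
Proof.
move=> DE; rewrite /Pr (_ : events _ = powerset (E :\: D)).
  rewrite card_powerset natrX cardsD (setIidPr DE).
  have DE' := subset_leq_card DE.
  by rewrite -{2}(subnKC DE') exprD invfM mulrC mulfVK // expf_neq0.
by apply/setP => F; rewrite !inE subsetD setI_eq0.
Qed.

(** The moment generating function of the number of chosen elements of D: the sum
factors over the elements of E. *)
Lemma sum_powerset_expr D (a : R) : D \subset E ->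
  \sum_(F in powerset E) a ^+ #|F :&: D| = (1 + a) ^+ #|D| * 2 ^+ (#|E| - #|D|).
Proof.
move=> DE; pose u e := if e \in D then a else 1.
(* Subsets that are not contained in E are given weight 0. *)
transitivity (\sum_(F in {set X})
    \prod_e (if e \in F then (if e \in E then u e else 0) else 1)).
  rewrite [RHS](bigID (fun F => F \in powerset E)) /= [X in _ = _ + X]big1 ?addr0.
    apply: eq_bigr => F; rewrite inE => /subsetP FE.
    rewrite -prodr_const [LHS]big_mkcond; apply: eq_bigr => e _; rewrite inE /u.
    by case: (boolP (e \in F)) => // /FE ->.
  move=> F; rewrite inE => /subsetPn [e eF eE].
  by rewrite (bigD1 e) //= eF (negbTE eE) mul0r.
rewrite -(bigA_distr _ _ (fun e => if e \in E then u e else 0) (fun=> 1)).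
rewrite -cardsDS // -!prodr_const [X in X * _]big_mkcond [X in _ * X]big_mkcond.
rewrite -big_split.
apply: eq_bigr => e _; rewrite inE /u /=.
case: (boolP (e \in D)) => [/(subsetP DE)->|_] /=; first by rewrite mulr1 addrC.
by case: (e \in E); rewrite !mul1r ?add0r //.
Qed.

(** Markov's inequality for a^|F :&: D|. *)
Lemma Pr_tail D (a : R) s : D \subset E -> 1 <= a ->
  Pr (fun F => s <= #|F :&: D|)%N <= ((1 + a) / 2) ^+ #|D| * a ^- s.
Proof.
move=> DE a1; have a0 : 0 < a by lra.
rewrite ler_pdivlMr ?exprn_gt0 // /Pr mulrAC ler_pdivrMr ?pow2_gt0 //.
have -> : ((1 + a) / 2) ^+ #|D| * 2 ^+ #|E| = (1 + a) ^+ #|D| * 2 ^+ (#|E| - #|D|) :> R.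
  rewrite -{1}(subnKC (subset_leq_card DE)) exprD mulrA expr_div_n.
  by rewrite divfK // expf_neq0.
rewrite -sum_powerset_expr // mulr_natl -sumr_const.
rewrite [leRHS](bigID (fun F => s <= #|F :&: D|)%N) /=.
rewrite -[X in X <= _]addr0; apply: lerD; last first.
  by apply: sumr_ge0 => F _; rewrite exprn_ge0 // ltW.
rewrite (eq_bigl (fun F => (F \in powerset E) && (s <= #|F :&: D|)%N)); last first.
  by move=> F; rewrite inE.
by apply: ler_sum => F /andP[_ sF]; rewrite ler_weXn2l.
Qed.

(** The choice a = 1 + 1/L in [Pr_tail]: the excess of ((1 + a)/2)^2 over a is only
1/(4 L^2), so that over m <= L t factors it costs at most a^t, while the
deviation t gains a^(2t). *)
Lemma chernoff_rate (L m t s : nat) : (0 < L)%N -> (m <= L * t)%N ->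
  (m + 2 * t <= 2 * s)%N ->
  (((1 + (1 + L%:R^-1)) / 2) ^+ m * (1 + L%:R^-1) ^- s) ^+ 2
     <= (1 + L%:R^-1) ^- t :> R.
Proof.
move=> L0 mLt ms; set y : R := L%:R^-1; set a := 1 + y.
have y0 : 0 < y by rewrite invr_gt0 ltr0n.
have yL : y * L%:R = 1 by rewrite mulVf // pnatr_eq0 -lt0n.
have y1 : y <= 1 by rewrite invf_le1 ?ltr0n // ler1n.
have a1 : 1 <= a by rewrite /a; lra.
have a0 : 0 < a by lra.
pose z := y ^+ 2; have z0 : 0 <= z by rewrite exprn_ge0 // ltW.
have bern j : (j <= L)%N -> (1 + z / 4) ^+ j <= 1 + j%:R * z.
  elim: j => [|j IH] jL; first by rewrite expr0 mul0r addr0.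
  have jy : j%:R * y <= 1.
    by rewrite -[leRHS]yL [leRHS]mulrC ler_pM2r // ler_nat ltnW.
  rewrite exprSr; apply: le_trans (_ : (1 + j%:R * z) * (1 + z / 4) <= _).
    by apply: ler_wpM2r; [lra|exact/IH/ltnW].
  have u1 : j%:R * z <= 1.
    by rewrite /z expr2 mulrA mulr_ile1 ?mulr_ge0 ?(ltW y0).
  have uz : j%:R * z * z <= z by rewrite ler_piMl.
  rewrite -(natr1 j); move: uz; set u := j%:R * z => uz.
  have -> : (1 + u) * (1 + z / 4) = 1 + u + z / 4 + u * z / 4 by field.
  have -> : 1 + (j%:R + 1) * z = 1 + u + z by rewrite /u; ring.
  lra.
have base : ((1 + a) / 2) ^+ 2 <= a * (1 + z / 4).
  have -> : ((1 + a) / 2) ^+ 2 = a + z / 4 by rewrite /z /a; field.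
  by rewrite mulrDr mulr1 lerD2l ler_peMl // divr_ge0.
have z4 : 1 <= 1 + z / 4 by lra.
have pow_le : (((1 + a) / 2) ^+ 2) ^+ m <= a ^+ (m + t).
  apply: (@le_trans _ _ ((a * (1 + z / 4)) ^+ m)).
    by apply: lerXn2r; rewrite ?nnegrE ?exprn_ge0 ?mulr_ge0 // ?ltW //; lra.
  rewrite exprMn exprD ler_pM2l ?exprn_gt0 //.
  apply: (@le_trans _ _ ((1 + z / 4) ^+ (L * t))).
    exact: ler_weXn2l.
  rewrite exprM; apply: lerXn2r; rewrite ?nnegrE ?exprn_ge0 //; try lra.
  have -> : a = 1 + L%:R * z; last exact: bern.
  by rewrite /a /z expr2 mulrA [L%:R * y]mulrC yL mul1r.
rewrite exprMn exprAC exprVn -(exprM a).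
rewrite ler_pdivrMr ?exprn_gt0 //; apply: (le_trans pow_le).
rewrite mulrC ler_pdivlMr ?exprn_gt0 // -exprD.
by apply: ler_weXn2l => //; lia.
Qed.
End UniformSubset.

(** * The blow-up of a cubic graph and the peeling process *)

Section BlowUp.
Variables (V : finType) (nb : 'I_3 -> V -> V) (m t : nat).
Hypothesis nbK : forall c, involutive (nb c).

Definition star (c : 'I_3) (x : V) (i : 'I_m) : {set {set V * 'I_m}} :=
  [set [set (x, i); (nb c x, j)] | j : 'I_m].

Definition bundle (c : 'I_3) (x : V) : {set {set V * 'I_m}} :=
  \bigcup_i star c x i.

Definition blowup : {set {set V * 'I_m}} := \bigcup_x \bigcup_c bundle c x.

Implicit Types (F G D : {set {set V * 'I_m}}).

(** The slack t absorbs the fluctuations around m/2 of the numbers of neighbours. *)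
Definition moderate (c : 'I_3) (x : V) : pred {set {set V * 'I_m}} :=
  fun F => [forall i, #|F :&: star c x i| <= m./2 + t]%N.

(** The intended meaning is [cleared_sound]: F contains no subgraph of large minimum
degree that uses the bundle between x and [nb c x].  J1 and J2 concern the two
other bundles at x, seen from their far ends, so that the recursion moves away from
[nb c x].  If both are cleared, a vertex of the blob x keeps at most m
neighbours.  If one is, the moderate sizes of the two remaining bundles leave
at most 2 (m/2 + t). *)
Fixpoint cleared (d : nat) (c : 'I_3) (x : V) : pred {set {set V * 'I_m}} :=
  fun F => if d is d'.+1 then
    let J1 := cleared d' (c + 1) (nb (c + 1) x) F in
    let J2 := cleared d' (c + 2) (nb (c + 2) x) F in
    J1 && J2 ||
    moderate c x F && (J1 && moderate (c + 2) x F || J2 && moderate (c + 1) x F)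
  else F :&: bundle c x == set0.

Lemma bundleP c x e :
  reflect (exists i j, e = [set (x, i); (nb c x, j)]) (e \in bundle c x).
Proof.
apply: (iffP bigcupP) => [[i _ /imsetP[j _ ->]]|[i [j ->]]]; first by exists i, j.
by exists i => //; apply/imsetP; exists j.
Qed.

Lemma bundle_nb c x : bundle c (nb c x) = bundle c x.
Proof.
apply/setP => e; apply/bundleP/bundleP => -[i [j ->]]; exists j, i;
  by rewrite ?nbK setUC.
Qed.

Lemma star_sub_bundle c x i : star c x i \subset bundle c x.
Proof. exact: (bigcup_sup i). Qed.

Lemma bundle_sub_blowup c x : bundle c x \subset blowup.
Proof. by apply: subset_trans (bigcup_sup x _) => //; apply: (bigcup_sup c). Qed.

Lemma incident_edges F x i : F \subset blowup ->
  [set e in F | (x, i) \in e] \subset \bigcup_c (F :&: star c x i).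
Proof.
move=> /subsetP FE; apply/subsetP => e; rewrite inE => /andP[eF xe].
have /bigcupP[y _ /bigcupP[c _ /bundleP[i' [j ee]]]] := FE _ eF.
apply/bigcupP; exists c => //; rewrite inE eF.
move: xe; rewrite {1}ee !inE => /orP[]/eqP[xy ij]; apply/imsetP.
  by exists j => //; rewrite xy ij.
by exists i' => //; rewrite ee xy ij nbK setUC.
Qed.

Lemma degree_le F x i : F \subset blowup ->
  (degree F (x, i) <= \sum_c #|F :&: star c x i|)%N.
Proof.
move=> FE; apply: leq_trans (subset_leq_card (incident_edges _ _ FE)) _.
elim/big_rec2: _ => [|c k U _ IH]; first by rewrite cards0.
by apply: leq_trans (leq_card_setU _ _) _; rewrite leq_add2l.
Qed.

Lemma card_star_le c x i : (#|star c x i| <= m)%N.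
Proof. by rewrite -[leqRHS]card_ord leq_imset_card. Qed.

Lemma sum_colours (f : 'I_3 -> nat) c :
  (\sum_d f d = f c + (f (c + 1)%R + f (c + 2)%R))%N.
Proof.
rewrite (perm_big [:: c; c + 1; c + 2]) ?big_cons ?big_nil /=; first by rewrite addn0.
apply: uniq_perm; rewrite ?index_enum_uniq //; first by case: c => [[|[|[|]]] ?].
move=> d; rewrite mem_index_enum !inE.
by case: c d => [[|[|[|]]] ?] // [[|[|[|]]] ?].
Qed.

Section Peeling.
Variables (F F' : {set {set V * 'I_m}}) (W : {set V * 'I_m}).
Hypothesis FE : F \subset blowup.
Hypothesis F'F : F' \subset F.
Hypothesis F'W : [forall e in F', e \subset W].
Hypothesis degW : forall v, v \in W -> (m + 2 * t < degree F' v)%N.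

(** An edge of the bundle has an endpoint in the blob x, which then lies in W and
must have large degree. *)
Lemma bundle_cleared c x :
  (forall i, \sum_c #|F' :&: star c x i| <= m + 2 * t)%N ->
  F' :&: bundle c x = set0.
Proof.
move=> low; apply/eqP/set0Pn => -[e]; rewrite inE => /andP[eF' /bundleP[i [j ee]]].
have xW : (x, i) \in W.
  by move/forall_inP/(_ _ eF')/subsetP: F'W; apply; rewrite ee set21.
have := degW xW; rewrite ltnNge (leq_trans (degree_le _ _ _)) //.
exact: subset_trans FE.
Qed.

Lemma cleared_sound d c x : cleared d c x F -> F' :&: bundle c x = set0.
Proof.
have sub0 c' y i : F' :&: bundle c' y = set0 -> #|F' :&: star c' y i| = 0%N.
  move=> E; apply/eqP; rewrite cards_eq0 -subset0 -E.
  by apply: setIS; apply: star_sub_bundle.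
have moderate_le c' y i : moderate c' y F -> (#|F' :&: star c' y i| <= m./2 + t)%N.
  by move=> /forallP/(_ i); apply: leq_trans; apply/subset_leq_card/setSI.
elim: d c x => [|d IH] c x /=.
  by move=> /eqP E; apply/eqP; rewrite -subset0 -E setSI.
have clr c' : cleared d c' (nb c' x) F -> F' :&: bundle c' x = set0.
  by move=> /IH; rewrite bundle_nb.
move=> H; apply: bundle_cleared => i; rewrite (sum_colours _ c).
have hm : (m./2 + m./2 <= m)%N by lia.
case/orP: H => [/andP[/clr/sub0-> /clr/sub0->]|].
  rewrite !addn0; apply: leq_trans (leq_addr _ _).
  by apply: leq_trans (card_star_le c x i); apply/subset_leq_card/subsetIr.
by case/andP => /(moderate_le _ _ i) h0 /orP[]/andP[/clr/sub0-> /(moderate_le _ _ i) h1];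
   rewrite ?addn0 ?add0n; apply: leq_trans (leq_add h0 h1) _; lia.
Qed.
End Peeling.

(** A subgraph in which all degrees exceed m + 2t would have no edge in any bundle,
hence no edge at all. *)
Lemma colouring_number_cleared d F : F \subset blowup ->
  (forall c x, cleared d c x F) -> (colouring_number F <= m + 2 * t + 1)%N.
Proof.
move=> FE clr; rewrite /colouring_number; case: ex_minnP => k _; apply.
apply/forallP => W; apply/forallP => F'; apply/implyP => /andP[/set0Pn[v vW]].
case/andP => F'F F'W; apply/existsP; apply: contrapT => /forallNP high.
have degW u : u \in W -> (m + 2 * t < degree F' u)%N.
  move=> uW; rewrite ltnNge; apply/negP => lo; apply: (high u).
  by rewrite uW /= addn1 ltnS.
have := degW v vW; case: v vW => x i _; rewrite ltnNge => /negP; apply.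
apply: leq_trans (degree_le _ _ (subset_trans F'F FE)) _.
rewrite big1 // => c _; apply/eqP; rewrite cards_eq0 -subset0.
rewrite -(cleared_sound FE F'F F'W degW (clr c x)).
by apply: setIS; apply: star_sub_bundle.
Qed.

(** The edges that the event [cleared d c x] looks at. *)
Fixpoint region (d : nat) (c : 'I_3) (x : V) : {set {set V * 'I_m}} :=
  if d is d'.+1 then bundle c x :|:
    (region d' (c + 1) (nb (c + 1) x) :|: region d' (c + 2) (nb (c + 2) x))
  else bundle c x.

Lemma bundle_sub_region d c x : bundle c x \subset region d c x.
Proof. by case: d => [|d] //=; rewrite subsetUl. Qed.

Lemma moderate_determined c x : determined_by (bundle c x) (moderate c x).
Proof.
move=> F G FG; rewrite /moderate; apply: eq_forallb => i.
by rewrite -(setIidPr (star_sub_bundle c x i)) !setIA FG.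
Qed.

Lemma cleared_determined d c x : determined_by (region d c x) (cleared d c x).
Proof.
elim: d c x => [|d IH] c x /= F G FG; first by rewrite FG.
have sub c' : region d c' (nb c' x) \subset region d.+1 c x ->
    (moderate c' x F = moderate c' x G) /\ (cleared d c' (nb c' x) F = cleared d c' (nb c' x) G).
  move=> sub; split; last exact: (determined_byW sub (IH _ _)).
  apply: (@determined_byW _ (bundle c' x) (region d.+1 c x)) => //;
    last exact: moderate_determined.
  by apply: subset_trans sub; rewrite -bundle_nb bundle_sub_region.
have [|-> ->] := sub (c + 1); first by rewrite /= setUCA subsetUl.
have [|-> ->] := sub (c + 2); first by rewrite /= setUA subsetUr.
by rewrite (@determined_byW _ _ _ _ (subsetUl _ _) (@moderate_determined c x) _ _ FG).
Qed.

Lemma region_walk d c x e : e \in region d c x ->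
  exists w, [/\ reduced (c :: w), (size w <= d)%N
    & e \in bundle (last c w) (walk nb w x)].
Proof.
elim: d c x => [|d IH] c x /=; first by exists [::].
have ext c' : c != c' -> e \in region d c' (nb c' x) ->
    exists w, [/\ reduced (c :: w), (size w <= d.+1)%N
      & e \in bundle (last c w) (walk nb w x)].
  move=> cc' /IH[w [rw sw ew]]; exists (c' :: w); split => //.
  by rewrite /reduced /= cc'.
rewrite !inE => /or3P[|/ext|/ext]; last 2 first.
- by apply; case: (c) => [[|[|[|]]] ?].
- by apply; case: (c) => [[|[|[|]]] ?].
by exists [::].
Qed.

Variable n : nat.
Hypothesis nb_free : acyclic_up_to nb n.
Hypothesis n2 : (2 <= n)%N.

Lemma nb_neq c x : nb c x != x.
Proof. by apply: (nb_free (w := [:: c])) => //; exact: ltnW. Qed.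

Lemma nb_colour_inj c d x : nb c x = nb d x -> c = d.
Proof.
by move=> E; have [] := @walk_unique _ nb n nbK nb_free [:: c] [:: d] x isT isT n2 E.
Qed.

Lemma bundle_inj c x d y e : e \in bundle c x -> e \in bundle d y ->
  d = c /\ (y = x \/ y = nb c x).
Proof.
move=> /bundleP[i [j ->]] /bundleP[i' [j' ee]].
have := set21 (y, i') (nb d y, j'); have := set22 (y, i') (nb d y, j').
rewrite -ee !inE !xpair_eqE => h2 h1.
have {h1} yx : y = x \/ y = nb c x.
  by case/orP: h1 => /andP[/eqP-> _]; [left|right].
split=> //; case: yx h2 => ->.
  rewrite (negbTE (nb_neq d x)) /= => /andP[/eqP E _]; exact: nb_colour_inj E.
rewrite (negbTE (nb_neq d _)) orbF => /andP[/eqP E _].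
by apply: (@nb_colour_inj _ _ (nb c x)); rewrite nbK.
Qed.

(** An edge in both regions is reached from x by two walks with different first
letters.  They pass its bundle in the same direction or in opposite
directions; in the second case, drop the last letter of one of them.  Either way two
different non-backtracking walks get the same endpoints. *)
Lemma region_disjoint c c' d d' x : c != c' -> (d + d' + 2 <= n)%N ->
  [disjoint region d c (nb c x) & region d' c' (nb c' x)].
Proof.
move=> cc' dn; apply/pred0P => e /=; apply/negP => /andP[].
move=> /region_walk[w [rw sw ew]] /region_walk[w' [rw' sw' ew']].
have [col end_eq] := bundle_inj ew ew'.
have size2 : (size (c :: w) + size (c' :: w') <= n)%N by rewrite /=; lia.
have uniq_walk u : reduced u -> (size u <= size (c' :: w'))%N ->
    walk nb (c :: w) x = walk nb u x -> c :: w = u.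
  move=> ru su; apply: (walk_unique nbK nb_free rw ru).
  by apply: leq_trans size2; rewrite leq_add2l.
case: end_eq => [E|E].
  have [cE _] := uniq_walk (c' :: w') rw' (leqnn _) (esym E).
  by rewrite cE eqxx in cc'.
have wE : c' :: w' = rcons (belast c' w') (last c' w') by rewrite -lastI.
have := uniq_walk (belast c' w'); rewrite size_belast leqnSn => /(_ _ isT).
have -> : walk nb (c :: w) x = walk nb (belast c' w') x.
  have := walk_rcons nb (belast c' w') (last c' w') x; rewrite -lastI /= E col.
  by move=> /(inv_inj (nbK _)).
rewrite (_ : reduced _ = true);
  last by apply: (@reduced_rconsW _ (last c' w')); rewrite -wE.
move=> /(_ isT erefl); case: (w') => //= ? ? [cE].
by rewrite cE eqxx in cc'.
Qed.

End BlowUp.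

(** * The recursion for the probability of clearing *)

(** The arithmetic of [cleared_growth]: x1 and x2 are the probabilities of the two
branches, and u that of their union after typicality is imposed.  The
bound (1 - 2 q) (x1 + x2) - x1 x2 is increasing in each variable only on a
bounded range, whence the case u <= 1/2. *)
Lemma growth_step (R : realType) (q y x1 x2 u i a b : R) :
  0 <= y -> y <= 1 / 2 -> q <= 1 / 16 -> y <= x1 -> y <= x2 -> 0 <= x1 -> 0 <= x2 ->
  x1 * (1 - 2 * q) <= a -> x2 * (1 - 2 * q) <= b -> a <= u -> b <= u -> u <= 1 / 2 ->
  u + i = a + b -> i <= x1 * x2 -> 5 / 4 * y <= u.
Proof.
move=> y0 y12 q16 x1y x2y x10 x20 b1 b2 U1 U2 PU UI PI.
have q2 : 7 / 8 <= 1 - 2 * q by lra.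
have h1 : x1 * (7 / 8) <= x1 * (1 - 2 * q) by apply: ler_wpM2l.
have h2 : x2 * (7 / 8) <= x2 * (1 - 2 * q) by apply: ler_wpM2l.
have s1 : x1 <= 5 / 8 by lra.
have s2 : x2 <= 5 / 8 by lra.
have p1 : 0 <= (x1 - y) * (5 / 8 - x2) by rewrite mulr_ge0 ?subr_ge0.
have p2 : 0 <= y * (1 / 2 - y) by rewrite mulr_ge0 ?subr_ge0.
have p3 : 0 <= (x2 - y) * (1 / 2 - y) by rewrite mulr_ge0 ?subr_ge0.
lra.
Qed.

(** How a bundle at a blob can fail to be cleared.  The letters j stand for the two
branches and g for the moderate bundles.  In the terms that combine the failure of
a branch with that of the bundle leading to it, j is weakened to s, an event that does
not look at that bundle: this restores independence. *)
Lemma failure_cases (j1 j2 s1 s2 g0 g1 g2 : bool) : (s1 -> j1) -> (s2 -> j2) ->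
  ~~ (j1 && j2 || g0 && (j1 && g2 || j2 && g1)) ->
  [|| ~~ j1 && ~~ j2, ~~ j1 && ~~ g0 || ~~ s1 && ~~ g1
    | ~~ j2 && ~~ g0 || ~~ s2 && ~~ g2].
Proof.
case: j1; case: j2; case: s1; case: s2; case: g0; case: g1; case: g2 => //= h1 h2 _;
  by [have := h1 isT|have := h2 isT].
Qed.

Section Recursion.
Variables (R : realType) (V : finType) (nb : 'I_3 -> V -> V) (m t n : nat).
Hypothesis nbK : forall c, involutive (nb c).
Hypothesis nb_free : acyclic_up_to nb n.
Hypothesis n2 : (2 <= n)%N.
Variable q : R.

Local Notation E := (blowup nb m).
Local Notation moderate := (moderate nb t).
Local Notation cleared := (cleared nb t).
Local Notation region := (region nb m).
Local Notation bundle := (bundle nb m).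
Local Notation P := (Pr R E).

Hypothesis moderate_likely : forall c x, P (predC (moderate c x)) <= q.

Lemma colour_neq (c : 'I_3) : [/\ c != c + 1, c != c + 2 & c + 1 != c + 2].
Proof. by case: c => [[|[|[|]]] ?]. Qed.

Lemma indep_branch d d' c c' x A B : c != c' -> (d + d' + 2 <= n)%N ->
  determined_by (region d c (nb c x)) A ->
  determined_by (region d' c' (nb c' x)) B ->
  P (predI A B) = P A * P B.
Proof.
by move=> cc' dn; apply/Pr_indep/(region_disjoint m nbK nb_free n2 x cc' dn).
Qed.

Lemma moderate_region d c x :
  determined_by (region d c (nb c x)) (moderate c x : pred {set {set V * 'I_m}}).
Proof.
apply: (@determined_byW _ (bundle c x)); last exact: moderate_determined.
by rewrite -bundle_nb // bundle_sub_region.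
Qed.

Lemma region_bundle_disjoint d c c' x : c != c' -> (d + 2 <= n)%N ->
  [disjoint region d c' (nb c' x) & bundle c x].
Proof.
move=> cc' dn; have := @region_disjoint _ _ m nbK _ nb_free n2 c' c d 0 x.
by rewrite addn0 /= bundle_nb // eq_sym; apply.
Qed.

Lemma indep_moderate c c' d x A : c != c' -> (d + 2 <= n)%N ->
  determined_by (region d c' (nb c' x)) A ->
  P (predI A (predC (moderate c x))) = P A * P (predC (moderate c x)).
Proof.
move=> cc' dn dA; apply: (@indep_branch d 0 c' c x); rewrite ?addn0 1?eq_sym //.
exact/determined_byC/moderate_region.
Qed.

(** One cleared branch suffices if the two other bundles are moderate, so that by
inclusion-exclusion the probability of success nearly doubles while it is small. *)
Lemma cleared_growth d (y : R) : q <= 1 / 16 -> (2 * d + 2 <= n)%N ->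
  0 <= y -> y <= 1 / 2 ->
  (forall c x, y <= P (cleared d c x)) ->
  forall c x, Num.min (1 / 2) (5 / 4 * y) <= P (cleared d.+1 c x).
Proof.
move=> q16 dn y0 y12 IH c x.
have [c01 c02 c12] := colour_neq c.
pose J c' := cleared d c' (nb c' x) : pred {set {set V * 'I_m}}.
pose g2 c' := predI (moderate c x) (moderate c' x) : pred {set {set V * 'I_m}}.
have Pg c' : 1 - 2 * q <= P (g2 c').
  have -> : P (g2 c') = 1 - P (predU (predC (moderate c x)) (predC (moderate c' x))).
    by rewrite -PrC; apply: eq_Pr => F /=; rewrite negb_or !negbK.
  by have := PrU_le R E (predC (moderate c x)) (predC (moderate c' x));
     have := moderate_likely c x; have := moderate_likely c' x; lra.
have indJ c1 c2 : c != c1 -> c1 != c2 ->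
    P (predI (J c1) (g2 c2)) = P (J c1) * P (g2 c2).
  move=> cc1 c12'.
  rewrite (@Pr_indep R _ E (region d c1 (nb c1 x)) (bundle c x :|: bundle c2 x)) //.
  - have dn2 : (d + 2 <= n)%N by lia.
    rewrite -setI_eq0 setIUr setU_eq0 !setI_eq0.
    by rewrite !region_bundle_disjoint // eq_sym.
  - exact: cleared_determined.
  - apply: determined_byI; [apply: (determined_byW (subsetUl _ _))
                           |apply: (determined_byW (subsetUr _ _))];
      exact: moderate_determined.
have P12 : P (predI (J (c + 1)) (J (c + 2))) = P (J (c + 1)) * P (J (c + 2)).
  have dn2 : (d + d + 2 <= n)%N by lia.
  by apply: (indep_branch c12 dn2); exact: cleared_determined.
set x1 := P (J (c + 1)); set x2 := P (J (c + 2)).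
have x1y : y <= x1 by exact: IH.
have x2y : y <= x2 by exact: IH.
have x10 : 0 <= x1 by exact: Pr_ge0.
have x20 : 0 <= x2 by exact: Pr_ge0.
pose U := predU (predI (J (c + 1)) (g2 (c + 2))) (predI (J (c + 2)) (g2 (c + 1))).
have UJ : P U <= P (cleared d.+1 c x).
  apply: Pr_le => F _ /=; rewrite -/(J _ F) -/(J _ F).
  by case/orP => /andP[-> /andP[-> ->]]; rewrite ?orbT.
have b1 : x1 * (1 - 2 * q) <= P (predI (J (c + 1)) (g2 (c + 2))).
  by rewrite indJ // ler_wpM2l.
have b2 : x2 * (1 - 2 * q) <= P (predI (J (c + 2)) (g2 (c + 1))).
  by rewrite indJ // 1?eq_sym // ler_wpM2l.
have U1 : P (predI (J (c + 1)) (g2 (c + 2))) <= P U.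
  by apply: Pr_le => F _ /= ->.
have U2 : P (predI (J (c + 2)) (g2 (c + 1))) <= P U.
  by apply: Pr_le => F _ /= ->; rewrite orbT.
have UI := PrUI R E (predI (J (c + 1)) (g2 (c + 2))) (predI (J (c + 2)) (g2 (c + 1))).
have P_both : P (predI (predI (J (c + 1)) (g2 (c + 2)))
                       (predI (J (c + 2)) (g2 (c + 1)))) <= x1 * x2.
  by rewrite -P12; apply: Pr_le => F _ /= /andP[/andP[-> _] /andP[-> _]].
rewrite -/U in UI.
apply: le_trans UJ; rewrite ge_min.
case: (leP (1 / 2) (P U)) => //= PU.
apply: (growth_step y0 y12 q16 x1y x2y x10 x20 b1 b2 _ _ _ UI P_both) => //.
exact: ltW.
Qed.

(** Failure requires two failed branches, of probability at most r^2, or one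
failed branch and a bundle that is not moderate.  When that bundle is the one
between x and [nb c x], the product bound is 2 (r q) in total.  When it leads to the failed
branch, independence is recovered by going one level further down, where one
of two branches fails, which gives 2 (2 r q) in total. *)
Lemma cleared_decay d (r : R) : (2 * d + 4 <= n)%N -> 0 <= r ->
  (forall c x, P (predC (cleared d c x)) <= r) ->
  (forall c x, P (predC (cleared d.+1 c x)) <= r) ->
  forall c x, P (predC (cleared d.+2 c x)) <= r * (r + 6 * q).
Proof.
move=> dn r0 IH0 IH1 c x.
have [c01 c02 c12] := colour_neq c.
pose J c' := cleared d.+1 c' (nb c' x) : pred {set {set V * 'I_m}}.
pose S c' := predI (cleared d (c' + 1) (nb (c' + 1) (nb c' x)))
                   (cleared d (c' + 2) (nb (c' + 2) (nb c' x))) : pred {set {set V * 'I_m}}.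
have PS c' : P (predC (S c')) <= 2 * r.
  rewrite (@eq_Pr R _ _ _ (predU (predC (cleared d (c' + 1) (nb (c' + 1) (nb c' x))))
             (predC (cleared d (c' + 2) (nb (c' + 2) (nb c' x)))))); last first.
    by move=> F; rewrite /= negb_and.
  by apply: le_trans (PrU_le _ _ _ _) _; have := IH0 (c' + 1) (nb (c' + 1) (nb c' x));
     have := IH0 (c' + 2) (nb (c' + 2) (nb c' x)); lra.
have SI c' : P (predI (predC (S c')) (predC (moderate c' x))) <= 2 * r * q.
  rewrite (@Pr_indep R _ E (region d (c' + 1) (nb (c' + 1) (nb c' x)) :|:
     region d (c' + 2) (nb (c' + 2) (nb c' x))) (bundle c' x)).
  - by apply: ler_pM; rewrite ?Pr_ge0.
  - have [c01' c02' _] := colour_neq c'.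
    rewrite -setI_eq0 setIUl setU_eq0 !setI_eq0 -(bundle_nb m nbK c' x).
    have dn2 : (d + 2 <= n)%N by lia.
    by rewrite !region_bundle_disjoint.
  - apply/determined_byC/determined_byI;
      [apply: (determined_byW (subsetUl _ _))|apply: (determined_byW (subsetUr _ _))];
      exact: cleared_determined.
  - exact/determined_byC/moderate_determined.
have J0 c' : c != c' -> P (predI (predC (J c')) (predC (moderate c x))) <= r * q.
  move=> cc'; rewrite (@indep_moderate c c' d.+1) //; last first.
  - exact/determined_byC/cleared_determined.
  - lia.
  by apply: ler_pM; rewrite ?Pr_ge0 // IH1.
have P12 : P (predI (predC (J (c + 1))) (predC (J (c + 2)))) <= r * r.
  rewrite (@indep_branch d.+1 d.+1 (c + 1) (c + 2) x) //; last first.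
  - exact/determined_byC/cleared_determined.
  - exact/determined_byC/cleared_determined.
  - lia.
  by apply: ler_pM; rewrite ?Pr_ge0 // IH1.
pose B1 := predU (predI (predC (J (c + 1))) (predC (moderate c x)))
                 (predI (predC (S (c + 1))) (predC (moderate (c + 1) x))).
pose B2 := predU (predI (predC (J (c + 2))) (predC (moderate c x)))
                 (predI (predC (S (c + 2))) (predC (moderate (c + 2) x))).
pose B0 := predI (predC (J (c + 1))) (predC (J (c + 2))).
have sub : P (predC (cleared d.+2 c x)) <= P (predU B0 (predU B1 B2)).
  apply: Pr_le => F _.
  have SJ c' : S c' F -> J c' F by rewrite /J /S /= => ->.
  exact: failure_cases (SJ (c + 1)) (SJ (c + 2)).
apply: (le_trans sub); apply: le_trans (PrU_le _ _ _ _) _.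
have := PrU_le R E B1 B2.
have := PrU_le R E (predI (predC (J (c + 1))) (predC (moderate c x)))
                 (predI (predC (S (c + 1))) (predC (moderate (c + 1) x))).
have := PrU_le R E (predI (predC (J (c + 2))) (predC (moderate c x)))
                 (predI (predC (S (c + 2))) (predC (moderate (c + 2) x))).
rewrite -/B1 -/B2.
have := J0 _ c01; have := J0 _ c02; have := SI (c + 1); have := SI (c + 2).
move: P12; rewrite -/B0.
have -> : r * (r + 6 * q) = r * r + (2 * (r * q) + 2 * (2 * r * q)) by ring.
lra.
Qed.
End Recursion.

(** * Estimates *)

Lemma prob_subgraph_half (R : realType) (T : finType) (E : {set {set T}}) A :
  prob_subgraph (2^-1 : R) E A = Pr R E A.
Proof.
rewrite /prob_subgraph /Pr (eq_bigr (fun=> 2^-1 ^+ #|E|)).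
  rewrite sumr_const exprVn -[LHS]mulr_natl.
  congr (_%:R / _).
  by apply: eq_card => F; rewrite [RHS]inE.
move=> F /andP[]; rewrite powersetE => /subset_leq_card leFE _.
have -> : 1 - 2^-1 = 2^-1 :> R by lra.
by rewrite -exprD subnKC.
Qed.

Lemma bernoulli_ineq (R : realType) (y : R) j : 0 <= y -> 1 + j%:R * y <= (1 + y) ^+ j.
Proof.
move=> y0; elim: j => [|j IH]; first by rewrite mul0r addr0 expr0.
rewrite exprSr; apply: (@le_trans _ _ ((1 + j%:R * y) * (1 + y))).
  rewrite -(natr1 j).
  have : 0 <= j%:R * y * y by rewrite !mulr_ge0.
  lra.
by apply: ler_wpM2r; [lra|].
Qed.

Lemma exists_natr_ge (R : realType) (K : R) : exists j : nat, K <= j%:R.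
Proof.
exists (Num.bound `|K|); apply: le_trans (ler_norm K) _.
exact/ltW/archi_boundP.
Qed.

Lemma exists_pow_ge (R : realType) (a K : R) : 1 < a -> exists j : nat, K <= a ^+ j.
Proof.
move=> a1; have a10 : 0 < a - 1 by lra.
have [j jK] := exists_natr_ge (K / (a - 1)).
exists j; rewrite -{1}(subrK 1 a) [a - 1 + 1]addrC.
apply: le_trans (bernoulli_ineq j (ltW a10)).
by move: jK; rewrite ler_pdivrMr //; lra.
Qed.

(** Bernoulli's inequality for a quarter of the exponent already gives growth of
order t^4. *)
Lemma pow_beats_square (R : realType) (y K : R) : 0 < y ->
  exists T, forall t, (T <= t)%N -> K * t%:R ^+ 2 <= (1 + y) ^+ t.
Proof.
move=> y0; have [s0 s0K] := exists_natr_ge (49 * `|K| / y ^+ 4).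
(* (s y)^4 >= K (7 s)^2 >= K t^2 as soon as s^2 y^4 >= 49 K. *)
exists (4 * s0 + 4)%N => t Tt; pose s := (t %/ 4)%N.
have s1 : (s0 <= s)%N by rewrite /s; lia.
have s2 : (1 <= s)%N by rewrite /s; lia.
have ts : (t <= 7 * s)%N by rewrite /s; lia.
have st : (4 * s <= t)%N by rewrite /s; lia.
move: s s1 s2 ts st => s s1 s2 ts st.
have yp : 0 < y ^+ 4 by rewrite exprn_gt0.
apply: (@le_trans _ _ ((s%:R * y) ^+ 4)).
  have K1 : K * t%:R ^+ 2 <= `|K| * (7 * s%:R) ^+ 2.
    apply: (@le_trans _ _ (`|K| * t%:R ^+ 2)).
      by rewrite ler_wpM2r ?ler_norm ?exprn_ge0.
    rewrite ler_wpM2l // lerXn2r ?nnegrE ?mulr_ge0 //.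
    by rewrite -natrM ler_nat.
  apply: (le_trans K1).
  have K2 : 49 * `|K| <= s%:R ^+ 2 * y ^+ 4.
    rewrite -ler_pdivrMr //; apply: (le_trans s0K).
    apply: (@le_trans _ _ s%:R); first by rewrite ler_nat.
    by rewrite -natrX ler_nat; case: (s) s2 => // k _; rewrite leq_pmulr.
  rewrite !exprMn.
  have -> : `|K| * (7 ^+ 2 * s%:R ^+ 2) = (49 * `|K|) * s%:R ^+ 2 by ring.
  have -> : s%:R ^+ 4 * y ^+ 4 = (s%:R ^+ 2 * y ^+ 4) * s%:R ^+ 2 by ring.
  by apply: ler_wpM2r => //; rewrite exprn_ge0.
apply: (@le_trans _ _ (((1 + y) ^+ s) ^+ 4)).
  apply: lerXn2r; rewrite ?nnegrE ?mulr_ge0 ?exprn_ge0 ?addr_ge0 ?(ltW y0) //.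
  by have := bernoulli_ineq s (ltW y0); lra.
by rewrite -exprM mulnC; apply: ler_weXn2l => //; lra.
Qed.

Section BlowUpEstimates.
Variables (R : realType) (V : finType) (nb : 'I_3 -> V -> V) (m t n : nat).
Hypothesis nbK : forall c, involutive (nb c).
Hypothesis nb_free : acyclic_up_to nb n.
Hypothesis n2 : (2 <= n)%N.
Local Notation E := (blowup nb m).
Local Notation P := (Pr R E).

Lemma card_star c x i : #|star nb (m:=m) c x i| = m.
Proof.
rewrite card_imset ?card_ord // => j j' /setP/(_ (nb c x, j)).
by rewrite !inE !xpair_eqE (negbTE (nb_neq nb_free n2 c x)) !eqxx /= => /esym/eqP.
Qed.

Lemma blowup_simple : simple_graph E.
Proof.
apply/forall_inP => e /bigcupP[x _ /bigcupP[c _ /bundleP[i [j ->]]]].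
by rewrite cards2 xpair_eqE [x == _]eq_sym (negbTE (nb_neq nb_free n2 c x)).
Qed.

Lemma degree_blowup v : (3 * m <= degree E v)%N.
Proof.
case: v => x i; rewrite /degree.
pose f (p : 'I_3 * 'I_m) := [set (x, i); (nb p.1 x, p.2)].
have f_inj : injective f.
  move=> [c j] [d k] /setP/(_ (nb c x, j)).
  rewrite !inE /= !xpair_eqE (negbTE (nb_neq nb_free n2 c x)) eqxx !eqxx /=.
  by move=> /esym/andP[/eqP/(nb_colour_inj nbK nb_free n2)-> /eqP->].
rewrite -[X in (X <= _)%N](_ : #|[set f p | p : 'I_3 * 'I_m]| = _); last first.
  by rewrite card_imset // card_prod !card_ord.
apply/subset_leq_card/subsetP => e /imsetP[[c j] _ ->]; rewrite !inE eqxx /= andbT.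
apply: (subsetP (bundle_sub_blowup _ _ c x)); apply/bundleP.
by exists i, j.
Qed.

Lemma cleared0_prob c x : 2 ^- (m * m) <= P (cleared nb t 0 c x).
Proof.
rewrite (@Pr_avoid R _ E (bundle nb m c x)); last exact: bundle_sub_blowup.
rewrite lef_pV2 ?posrE ?exprn_gt0 // ler_weXn2l ?ler1n //.
have -> : bundle nb m c x = [set [set (x, p.1); (nb c x, p.2)] | p : 'I_m * 'I_m].
  apply/setP => e; apply/bundleP/imsetP => [[i [j ->]]|[[i j] _ ->]]; last by exists i, j.
  by exists (i, j).
by apply: leq_trans (leq_imset_card _ _) _; rewrite card_prod !card_ord.
Qed.

(** Squared, so that [chernoff_rate] applies without square roots. *)
Lemma moderate_fail_le (L : nat) c x : (0 < L)%N -> (m <= L * t)%N ->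
  P (predC (moderate (m:=m) nb t c x)) ^+ 2 <= m%:R ^+ 2 * (1 + L%:R^-1) ^- t.
Proof.
move=> L0 mLt; set a : R := 1 + L%:R^-1.
have a1 : 1 <= a by rewrite /a lerDl invr_ge0.
pose s := (m./2 + t).+1.
pose tail : R := ((1 + a) / 2) ^+ m * a ^- s.
have tail_le : tail ^+ 2 <= a ^- t by apply: chernoff_rate => //; rewrite /s; lia.
have fail : P (predC (moderate (m:=m) nb t c x)) <= m%:R * tail.
  rewrite (@eq_Pr R _ _ _ (fun F => [exists i, s <= #|F :&: star nb c x i|]%N)); last first.
    by move=> F; rewrite /= /moderate negb_forall; apply: eq_existsb => i; rewrite -ltnNge.
  apply: (@le_trans _ _ (#|'I_m|%:R * tail)); last by rewrite card_ord.
  apply: Pr_exists_le => i.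
  have -> : tail = ((1 + a) / 2) ^+ #|star nb c x i| * a ^- s by rewrite card_star.
  apply: Pr_tail => //.
  exact: subset_trans (star_sub_bundle _ _ _ _) (bundle_sub_blowup _ _ _ _).
apply: (@le_trans _ _ ((m%:R * tail) ^+ 2)).
  apply: lerXn2r; rewrite ?nnegrE ?Pr_ge0 //; apply: le_trans fail; exact: Pr_ge0.
by rewrite exprMn ler_wpM2l // exprn_ge0.
Qed.
End BlowUpEstimates.

(** * The upper bound *)

(** The depth D0 at which the fast decay begins depends on m only, and neither on H nor
on its girth: this is what allows H to be chosen afterwards, with girth
proportional to the depth that is needed. *)
Lemma uncleared_decay (R : realType) (m : nat) (h : R) : 0 < h -> h <= 1 / 4 ->
  exists D0 : nat, forall (V : finType) (nb : 'I_3 -> V -> V) (t n : nat),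
    (forall c, involutive (nb c)) -> acyclic_up_to nb n -> (2 <= n)%N ->
    (forall c x, Pr R (blowup nb m) (predC (moderate nb t c x)) <= h / 12) ->
    forall j d, (D0 + 2 * j <= d)%N -> (2 * d <= n)%N -> forall c x,
      Pr R (blowup nb m) (predC (cleared nb t d c x)) <= h / 2 * h ^+ j.
Proof.
move=> h0 h4.
have [d1 Hd1] : exists d1 : nat, 2 ^+ (m * m) <= (5 / 4 : R) ^+ d1.
  by apply: exists_pow_ge; lra.
have [j0 Hj0] : exists j0 : nat, h^-1 <= (8 / 5 : R) ^+ j0.
  by apply: exists_pow_ge; lra.
(* With q <= h/12 the term 6 q of the recursion is at most h/2; the phase that
   starts from 1/2 contracts by 5/8 until r <= h/2, and from then on by h. *)
exists (d1 + 2 * j0)%N => V nb t n nbK nb_free n2 moderate_likely.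
have q16 : h / 12 <= 1 / 16 by lra.
pose P := Pr R (blowup nb m).
pose J d c x := cleared nb t d c x : pred {set {set V * 'I_m}}.
have grow d : (2 * d <= n)%N -> forall c x,
    Num.min (1 / 2) ((5 / 4) ^+ d * 2 ^- (m * m)) <= P (J d c x).
  elim: d => [_ c x|d IH dn c x].
    rewrite expr0 ge_min [X in _ || (X <= _)]mul1r; apply/orP; right.
    exact: cleared0_prob.
  set y := Num.min _ _ in IH.
  have y0 : 0 <= y.
    rewrite le_min; apply/andP; split; first by lra.
    by rewrite mulr_ge0 ?invr_ge0 ?exprn_ge0 //; lra.
  have y12 : y <= 1 / 2 by rewrite ge_min lexx.
  have dn' : (2 * d + 2 <= n)%N by lia.
  have dn'' : (2 * d <= n)%N by lia.
  apply: le_trans (cleared_growth nbK nb_free n2 moderate_likely q16 dn' y0 y12 (IH dn'') c x).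
  have y2 : 5 / 4 * y = Num.min (5 / 4 * (1 / 2)) ((5 / 4) ^+ d.+1 * 2 ^- (m * m)).
    by rewrite /y minr_pMr ?exprS ?mulrA //; lra.
  rewrite y2 !le_min !ge_min !lexx orbT /= andbT; apply/orP; left; lra.
have half d : (d1 <= d)%N -> (2 * d <= n)%N -> forall c x, P (predC (J d c x)) <= 1 / 2.
  move=> d1d dn c x; have := grow d dn c x; rewrite /P PrC.
  suff -> : Num.min (1 / 2) ((5 / 4) ^+ d * 2 ^- (m * m)) = 1 / 2 :> R by lra.
  apply: min_l; rewrite ler_pdivlMr ?exprn_gt0 //.
  apply: (@le_trans _ _ ((5 / 4) ^+ d)); last by [].
  apply: (@le_trans _ _ ((5 / 4) ^+ d1)); last by apply: ler_weXn2l => //; lra.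
  have p0 : 0 < 2 ^+ (m * m) :> R by rewrite exprn_gt0.
  by apply: le_trans Hd1; lra.
have step r (lam : R) d2 : 0 <= r -> r + h / 2 <= lam ->
    (forall d, (d2 <= d)%N -> (2 * d <= n)%N -> forall c x, P (predC (J d c x)) <= r) ->
    (forall d, (d2 + 2 <= d)%N -> (2 * d <= n)%N -> forall c x, P (predC (J d c x)) <= lam * r).
  move=> r0 rl IH [|[|d]] d2d dn c x; try lia.
  have [a b] : (d2 <= d)%N /\ (d2 <= d.+1)%N by lia.
  have [dn1 dn2 dn3] : [/\ 2 * d + 4 <= n, 2 * d <= n & 2 * d.+1 <= n]%N by split; lia.
  have dec := cleared_decay nbK nb_free n2 moderate_likely dn1 r0 (IH d a dn2) (IH _ b dn3) c x.
  apply: (le_trans dec).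
  by rewrite mulrC ler_wpM2r //; lra.
have phase2 j d : (d1 + 2 * j <= d)%N -> (2 * d <= n)%N -> forall c x,
    P (predC (J d c x)) <= (5 / 8) ^+ j * (1 / 2).
  elim: j d => [|j IH] d jd; first by rewrite expr0 mul1r; apply: half; lia.
  rewrite exprS -mulrA; apply: (step _ (5 / 8) (d1 + 2 * j)%N); last by lia.
  - by rewrite mulr_ge0 ?exprn_ge0 //; lra.
  - have : (5 / 8 : R) ^+ j <= 1 by rewrite exprn_ile1 //; lra.
    lra.
  - exact: IH.
elim=> [|j IH] d jd dn c x.
  rewrite expr0 mulr1; apply: le_trans (phase2 j0 d _ dn c x) _; first by lia.
  rewrite mul1r ler_pM2r ?invr_gt0 //.
  have -> : 5 / 8 = (8 / 5)^-1 :> R by rewrite invf_div.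
  by rewrite exprVn invf_ple ?posrE // exprn_gt0 //; lra.
rewrite exprS mulrCA; apply: (step _ h (d1 + 2 * j0 + 2 * j)%N _ _ IH) => //; last by lia.
  by rewrite mulr_ge0 ?exprn_ge0 //; lra.
have : h ^+ j <= 1 by rewrite exprn_ile1 //; lra.
have : 0 <= h ^+ j by rewrite exprn_ge0 //; lra.
nra.
Qed.

(** With n = 2 d, where d = D0 + 1 + 2 j, the union bound is over the 3 * 16^n = 3 * 2^(8 d)
pairs of a colour and a vertex, each of which fails with probability at most h/2 * h^j, h = 2^-17.  As
8 d = 8 (D0 + 1) + 16 j, the choice j = 8 (D0 + 1) makes 16^n h^j equal to 1. *)
Lemma frakD_le (R : realType) (k m t L : nat) :
  (0 < L)%N -> (0 < m)%N -> (m <= L * t)%N -> (k <= 3 * m)%N ->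
  (12 * 2 ^+ 17) ^+ 2 * m%:R ^+ 2 <= (1 + L%:R^-1 : R) ^+ t ->
  (frakD R k <= m + 2 * t + 1)%N.
Proof.
move=> L0 m0 mLt km tail; rewrite leqNgt; apply/negP => big.
pose h : R := 2 ^- 17.
have h0 : 0 < h by rewrite invr_gt0 exprn_gt0.
have h4 : h <= 1 / 4.
  have -> : 1 / 4 = 2 ^- 2 :> R by rewrite -natrX div1r.
  by rewrite lef_pV2 ?posrE ?exprn_gt0 // ler_weXn2l ?ler1n.
have [D0 decay] := uncleared_decay m h0 h4.
pose j := (8 * D0.+1)%N; pose d := (D0.+1 + 2 * j)%N; pose n := (2 * d)%N.
pose V := useries n; pose nb := @series_nb n.
have nbK : forall c, involutive (nb c) := @series_nbK n.
have nb_free : acyclic_up_to nb n := @series_nb_acyclic n.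
have n2 : (2 <= n)%N by rewrite /n /d; lia.
pose P := Pr R (blowup nb m).
have moderate_likely c x : P (predC (moderate nb t c x)) <= h / 12.
  have /= le2 := moderate_fail_le R nb_free n2 c x L0 mLt.
  rewrite -[_ <= _](@ler_pXn2r _ 2) ?nnegrE ?Pr_ge0 ?divr_ge0 ?(ltW h0) //.
  apply: (le_trans le2); rewrite ler_pdivrMr; last by rewrite exprn_gt0 // ltr_wpDr ?invr_ge0.
  have -> : h / 12 = (12 * 2 ^+ 17)^-1 by rewrite invfM mulrC.
  by rewrite exprVn -ler_pdivrMl ?invrK ?invr_gt0 ?exprn_gt0 ?mulr_gt0 ?exprn_gt0.
have card_V : (0 < #|{: V * 'I_m}|)%N.
  by rewrite card_prod card_ord muln_gt0 m0 card_useries expn_gt0.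
move: big; rewrite /frakD; case: ex_maxnP => D /asboolP bound _ big.
have := bound _ (blowup nb m) card_V (blowup_simple m nb_free n2).
have deg v : (k <= degree (blowup nb m) v)%N.
  exact: leq_trans km (degree_blowup nbK nb_free n2 v).
move=> /(_ deg); rewrite prob_subgraph_half leNgt => /negP; apply.
pose uncleared (p : 'I_3 * V) : pred {set {set V * 'I_m}} :=
  predC (cleared nb t d p.1 p.2).
apply: (@le_lt_trans _ _ (P (fun F => [exists p, uncleared p F]))).
  apply: Pr_le => F FE DF; apply: contraT => /existsPn all_cleared.
  have : (colouring_number F <= m + 2 * t + 1)%N.
    apply: (@colouring_number_cleared _ _ m t nbK d F FE) => c x.
    by have := all_cleared (c, x); rewrite negbK.
  by rewrite leqNgt (leq_trans big DF).
apply: (@le_lt_trans _ _ (#|{: 'I_3 * V}|%:R * (h / 2 * h ^+ j))).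
  apply: Pr_exists_le => -[c x]; apply: (decay V nb t n) => //; rewrite /d; lia.
rewrite card_prod card_ord card_useries natrM natrX mulrACA.
have -> : 16 ^+ n * h ^+ j = 1 :> R.
  rewrite /h exprVn -exprM (_ : 16 = 2 ^+ 4 :> R); last by rewrite -natrX.
  rewrite -exprM (_ : (4 * n = 17 * j)%N) ?divff ?expf_neq0 //.
  rewrite /n /d /j; lia.
lra.
Qed.

(** Take m just above k/3 and t just above m/L with L >= 4/eps, so that 2t is at
most eps k/2 up to a constant. *)
Lemma frakD_asymptotic (R : realType) (eps : R) : 0 < eps ->
  exists K : nat, forall k : nat, (K <= k)%N ->
    (frakD R k)%:R <= k%:R / 3 + eps * k%:R.
Proof.
move=> eps0.
have [L HL] := exists_natr_ge (4 / eps).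
have L0 : 0 < L%:R :> R by apply: lt_le_trans HL; rewrite divr_gt0.
have L0' : (0 < L)%N by rewrite -(ltr0n R).
have iL0 : 0 < L%:R^-1 :> R by rewrite invr_gt0.
have [T HT] := pow_beats_square ((12 * 2 ^+ 17) ^+ 2 * L%:R ^+ 2) iL0.
have [K0 HK0] := exists_natr_ge (8 / eps).
exists (K0 + 3 * (L * T) + 3)%N => k kK.
pose m := (k %/ 3).+1; pose t := (m %/ L).+1.
have mLt : (m <= L * t)%N by rewrite /t mulnC ltnW // ltn_ceil.
have Tt : (T <= t)%N.
  by rewrite /t ltnW // ltnS leq_divRL // /m; lia.
have tail : (12 * 2 ^+ 17) ^+ 2 * m%:R ^+ 2 <= (1 + L%:R^-1 : R) ^+ t.
  apply: le_trans (HT t Tt).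
  rewrite -mulrA -(exprMn 2 L%:R) ler_wpM2l ?exprn_ge0 ?mulr_ge0 ?exprn_ge0 //.
  by rewrite lerXn2r ?nnegrE ?mulr_ge0 // -natrM ler_nat.
have m0 : (0 < m)%N by [].
have km : (k <= 3 * m)%N by rewrite /m; lia.
have := frakD_le L0' m0 mLt km tail; rewrite -(ler_nat R) => /le_trans; apply.
have mk : m%:R <= k%:R / 3 + 1 :> R.
  rewrite -(ler_pM2r (_ : 0 < 3)) // mulrDl divfK // mul1r -natrM -natrD ler_nat.
  by rewrite /m; lia.
have mk' : m%:R <= k%:R :> R by rewrite ler_nat /m; lia.
have tL : t%:R <= m%:R / L%:R + 1 :> R.
  rewrite /t -(natr1 (m %/ L)) lerD2r ler_pdivlMr // -natrM ler_nat.
  exact: leq_trunc_div.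
have mL : m%:R / L%:R <= eps / 4 * k%:R.
  rewrite ler_pdivrMr //; apply: (le_trans mk').
  move: HL; rewrite ler_pdivrMr // => HL.
  have k0 : 0 <= k%:R :> R by [].
  have : 0 <= k%:R * (L%:R * eps - 4) by rewrite mulr_ge0 // subr_ge0.
  lra.
have keps : 8 <= eps * k%:R.
  move: HK0; rewrite ler_pdivrMr // mulrC => /le_trans; apply.
  by rewrite ler_pM2l // ler_nat; lia.
rewrite !natrD natrM; lra.
Qed.

Local Open Scope classical_set_scope.
Local Open Scope ring_scope.

Theorem theorem1p4 (R : realType) :
  exists2 e : nat -> R, e =o_\oo (fun k : nat => k%:R : R)
    & forall k : nat, (frakD R k)%:R <= k%:R / 3 + e k.
Proof.
exists (fun k => Num.max 0 ((frakD R k)%:R - k%:R / 3)); last first.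
  by move=> k; rewrite -lerBlDl le_max lexx orbT.
apply/eqoP => eps eps0; have [K HK] := frakD_asymptotic eps0.
exists K => // k /= /HK frakD_k.
rewrite ger0_norm ?le_max ?lexx // ger0_norm // ge_max mulr_ge0 ?(ltW eps0) //=.
lra.
Qed.
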